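(* Let $J$ denote either $(0,1]$ or $[1,\infty)$, and let $L(x)=\log_2(1+x)$. Then: (i) The function $L$ has the $l$-Weierstrass property on $J$, i.e. $L(xy)\geq L(x)+L(y)-1$ for all $x,y\in J$, and the inequality is strict for $x\neq y$ with $x,y\in J$. Hence, $L$ is a Weierstrass function on $J$. (ii) For every $n\geq 2$ and $x_1,\dots,x_n\in J$, $$\prod_{i=1}^{n}(1+x_i)\leq 2^{n-1}\cdot\left(1+\prod_{i=1}^{n}x_i\right).$$
   Context: Let $J$ be either $(0,1]$ or $[1,\infty)$. A positive function $f$ on $J$ with $f(1)=1$ is called $l$-Weierstrass on $J$ (has the $l$-Weierstrass property on $J$) if $f(xy)\geq f(x)+f(y)-1$ for all $x,y\in J$; it is called a Weierstrass function on $J$ if $f(x)+f(y)-1\leq f(xy)\leq f(x)f(y)$ for all $x,y\in J$. Here $\log_2$ denotes the logarithm in base $2$.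
   Formalization: The inequality in (i) is proved strict for all x, y in J with x ≠ 1 and y ≠ 1, instead of for x ≠ y; as written the claim fails when x = 1 or y = 1 (e.g. x = 1, y = 2), where equality holds. *)

(* Defs.v *)
From mathcomp Require Import all_boot all_order all_algebra.
From mathcomp Require Import classical_sets reals exp.
Set Implicit Arguments.
Unset Strict Implicit.
Unset Printing Implicit Defensive.
Import Order.TTheory GRing.Theory Num.Theory.
Local Open Scope classical_set_scope.
Local Open Scope ring_scope.

Definition log2 {R : realType} (x : R) : R := ln x / ln 2.

(* A function on J is represented by a total function on R of which only the
   values on J matter: J will be `]0, 1] or `[1, +oo[, which contains 1 and is
   closed under multiplication. *)

Definition positive_normalized {R : realType} (J : set R) (f : R -> R) : Prop :=
  (forall x, J x -> 0 < f x) /\ f 1 = 1.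

Definition l_weierstrass {R : realType} (J : set R) (f : R -> R) : Prop :=
  positive_normalized J f /\
  (forall x y, J x -> J y -> f x + f y - 1 <= f (x * y)).

Definition weierstrass {R : realType} (J : set R) (f : R -> R) : Prop :=
  positive_normalized J f /\
  (forall x y, J x -> J y -> f x + f y - 1 <= f (x * y) <= f x * f y).

(* Main.v *)
Require Import Defs.
From mathcomp Require Import all_boot all_order all_algebra.
From mathcomp Require Import classical_sets set_interval reals exp.
From mathcomp Require Import interval_inference convex hoelder.
From mathcomp Require Import ring lra.
Import Order.TTheory GRing.Theory Num.Theory.
Local Open Scope classical_set_scope.
Local Open Scope ring_scope.

(** Two numbers of J lie on the same side of 1, so (1 - x)(1 - y) >= 0, which is
    the same as (1 + x)(1 + y) <= 2(1 + xy) since the two sides differ by exactly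
    (1 - x)(1 - y). Base-2 logarithms turn this into the lower bound
    L x + L y - 1 <= L (xy), strict as soon as neither number is 1, and
    iterating it along a product gives (ii), because J contains the partial
    products.

    The upper bound L (xy) <= L x * L y is not a consequence of the lower one.
    It comes from [ln1p_ratio_nondecreasing]: for 0 < y <= 1 the ratio
    ln (1 + ty) / ln (1 + t) is nondecreasing in t > 0. On (0,1], comparing the
    ratio at t = x and at t = 1 gives the bound. On [1,+oo) the ratio with
    parameter 1/y is compared at t = y and at t = xy.

    The monotonicity needs no derivative. The ratio at t is the inverse of the
    exponent p >= 1 such that (1 + ty)^p = 1 + t. Since u |-> (1 + u)^p is
    convex, its chords issued from u = 0 have nondecreasing slopes
    ([powR_chord_slope_nondecreasing]); the chord to ty has slope 1/y by the
    choice of p, so for t' >= t the slope at t'y is at least 1/y, that is,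
    (1 + t'y)^p >= 1 + t'. Taking logarithms gives the claim. *)

(** * Monotone ratio of logarithms *)

(** Chords of the convex function u |-> (1 + u)^p from u = 0, with their slopes
    compared after clearing the denominators a and b. *)
Lemma powR_chord_slope_nondecreasing (R : realType) (p a b : R) :
  1 <= p -> 0 <= a -> a <= b ->
  b * ((1 + a) `^ p - 1) <= a * ((1 + b) `^ p - 1).
Proof.
move=> p1 a0 ab.
have [b0|bn0] := eqVneq b 0.
  have -> : a = 0 by lra.
  by rewrite b0 !mul0r.
have b0 : 0 < b by rewrite lt_neqAle eq_sym bn0 (le_trans a0 ab).
have t0 : 0 <= a / b by rewrite divr_ge0// ltW.
have t1 : a / b <= 1 by rewrite ler_pdivrMr// mul1r.
have in_dom (u : R) : 0 <= u -> 1 + u \in (`[0, +oo[%classic : set R).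
  by move=> u0; rewrite inE/= in_itv/= andbT; lra.
have := convex_powR p1 (Itv01 t0 t1) (in_dom _ (ltW b0)) (in_dom _ (lexx 0)).
rewrite convRE [X in X `^ _ <= _]convRE/= /unstable.onem addr0 powR1.
(* 1 + a is the barycentre of 1 + b and 1 with weights a / b and 1 - a / b. *)
have -> : a / b * (1 + b) + (1 - a / b) * 1 = 1 + a by field.
rewrite -(ler_pM2l b0) => h.
have E : b * (a / b * (1 + b) `^ p + (1 - a / b) * 1)
         = a * (1 + b) `^ p + (b - a) by field.
rewrite E in h; lra.
Qed.

Lemma ln1p_ratio_nondecreasing (R : realType) (y a b : R) :
  0 < y -> y <= 1 -> 0 < a -> a <= b ->
  ln (1 + a * y) * ln (1 + b) <= ln (1 + a) * ln (1 + b * y).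
Proof.
move=> y0 y1 a0 ab.
have b0 : 0 < b by exact: lt_le_trans ab.
have ay0 : 0 < a * y by exact: mulr_gt0.
have by0 : 0 < b * y by exact: mulr_gt0.
have aya : a * y <= a by rewrite ler_piMr// ltW.
have lay : 0 < ln (1 + a * y) by rewrite ln_gt0//; lra.
set p := ln (1 + a) / ln (1 + a * y).
have p1 : 1 <= p.
  by rewrite ler_pdivlMr// mul1r ler_ln ?posrE; lra.
have pE : (1 + a * y) `^ p = 1 + a.
  apply: ln_inj; rewrite ?posrE ?powR_gt0; try lra.
  by rewrite ln_powR divfK// gt_eqF.
have := @powR_chord_slope_nondecreasing R p (a * y) (b * y) p1 (ltW ay0).
rewrite ler_pM2r// ab => /(_ isT).
rewrite pE.
have -> : b * y * (1 + a - 1) = a * y * b by ring.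
rewrite ler_pM2l// lerBrDl => powb.
have : ln (1 + b) <= p * ln (1 + b * y).
  by rewrite -ln_powR ler_ln ?posrE ?powR_gt0//; lra.
by rewrite /p mulrAC ler_pdivlMr// mulrC.
Qed.

(** * The two intervals *)

Section Interval.
Variables (R : realType) (J : set R).
Hypothesis hJ : J = `]0, 1]%classic \/ J = `[1, +oo[%classic.

Lemma itvJ_case x y : J x -> J y ->
  (0 < x <= 1 /\ 0 < y <= 1) \/ (1 <= x /\ 1 <= y).
Proof.
by case: hJ => ->; rewrite /= !in_itv/= ?andbT => xJ yJ; [left|right].
Qed.

Lemma itvJ_gt0 x : J x -> 0 < x.
Proof. by move=> xJ; case: (itvJ_case x x xJ xJ) => -[]; lra. Qed.

Lemma itvJ_1 : J 1.
Proof. by case: hJ => ->; rewrite /= in_itv/= ?ltr01 lexx. Qed.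

Lemma itvJ_M x y : J x -> J y -> J (x * y).
Proof.
case: hJ => -> /=; rewrite !in_itv/= ?andbT.
  by move=> /andP[x0 x1] /andP[y0 y1]; rewrite mulr_gt0//= mulr_ile1// ltW.
by move=> x1 y1; rewrite -[1]mulr1 ler_pM.
Qed.

(** * Bounds on products of the factors 1 + x *)

(** The difference of the two sides is (1 - x)(1 - y). *)
Lemma itvJ_mul1D_le x y : J x -> J y -> (1 + x) * (1 + y) <= 2 * (1 + x * y).
Proof.
move=> xJ yJ.
have : 0 <= (1 - x) * (1 - y).
  case: (itvJ_case x y xJ yJ) => -[h1 h2].
    by rewrite mulr_ge0//; lra.
  by rewrite -mulrNN mulr_ge0//; lra.
lra.
Qed.

Lemma itvJ_mul1D_lt x y : J x -> J y -> x <> 1 -> y <> 1 ->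
  (1 + x) * (1 + y) < 2 * (1 + x * y).
Proof.
move=> xJ yJ /eqP xn1 /eqP yn1; rewrite lt_neqAle itvJ_mul1D_le// andbT.
rewrite -subr_eq0.
have -> : (1 + x) * (1 + y) - 2 * (1 + x * y) = - ((x - 1) * (y - 1)) by ring.
by rewrite oppr_eq0 mulf_eq0 !subr_eq0 negb_or xn1.
Qed.

Lemma itvJ_prod n (x : 'I_n -> R) : (forall i, J (x i)) -> J (\prod_(i < n) x i).
Proof.
by move=> xJ; elim/big_ind: _ => //; [exact: itvJ_1|exact: itvJ_M].
Qed.

(** Each step merges two factors into one by applying [itvJ_mul1D_le] to a
    partial product, which is again in J, and the next entry; the n - 1 mergings
    cost one factor 2 each. *)
Lemma itvJ_prod1D_le n (x : 'I_n -> R) : (forall i, J (x i)) ->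
  \prod_(i < n) (1 + x i) <= 2 ^+ n.-1 * (1 + \prod_(i < n) x i).
Proof.
elim: n x => [|[|n] IHn] x xJ /=.
- by rewrite !big_ord0 expr0 mul1r lerDl.
- by rewrite !big_ord_recr !big_ord0 /= expr0 !mul1r.
rewrite 2!(big_ord_recr n.+1)/=; set y := x ord_max.
set P := \prod_(i < n.+1) x _.
have PJ : J P by apply: itvJ_prod => i; exact: xJ.
have y0 : 0 < y by apply: itvJ_gt0; exact: xJ.
apply: (@le_trans _ _ (2 ^+ n * (1 + P) * (1 + y))).
  by rewrite ler_pM2r; [exact: IHn|lra].
rewrite exprSr -!mulrA ler_pM2l ?exprn_gt0//.
by rewrite itvJ_mul1D_le//; exact: xJ.
Qed.

(** * The logarithm *)

(** Writes the lower bound as a single logarithm, so that it becomes an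
    inequality between its arguments. *)
Lemma log2D_sub1 (u v : R) : 0 < u -> 0 < v ->
  log2 u + log2 v - 1 = log2 (u * v / 2).
Proof.
move=> u0 v0.
have l2 : ln (2 : R) != 0 by rewrite gt_eqF// ln_gt0// ltr1n.
rewrite /log2 lnM ?posrE ?mulr_gt0// lnM ?posrE// lnV ?posrE//.
by field.
Qed.

Lemma itvJ_log2_l_weierstrass x y : J x -> J y ->
  log2 (1 + x) + log2 (1 + y) - 1 <= log2 (1 + x * y).
Proof.
move=> xJ yJ; have x0 := itvJ_gt0 x xJ; have y0 := itvJ_gt0 y yJ.
have xy0 := mulr_gt0 x0 y0.
rewrite log2D_sub1; try lra.
rewrite ler_pM2r ?invr_gt0 ?ln_gt0 ?ltr1n// ler_ln ?posrE; try lra.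
- by rewrite ler_pdivrMr// mulrC -(mulrC 2) (mulrC (1 + y)) itvJ_mul1D_le.
Qed.

Lemma itvJ_log2_l_weierstrass_strict x y : J x -> J y -> x <> 1 -> y <> 1 ->
  log2 (1 + x) + log2 (1 + y) - 1 < log2 (1 + x * y).
Proof.
move=> xJ yJ xn1 yn1; have x0 := itvJ_gt0 x xJ; have y0 := itvJ_gt0 y yJ.
have xy0 := mulr_gt0 x0 y0.
rewrite log2D_sub1; try lra.
rewrite ltr_pM2r ?invr_gt0 ?ln_gt0 ?ltr1n// ltr_ln ?posrE; try lra.
- by rewrite ltr_pdivrMr// mulrC -(mulrC 2) (mulrC (1 + y)) itvJ_mul1D_lt.
Qed.

Lemma itvJ_ln1p_submultiplicative x y : J x -> J y ->
  ln 2 * ln (1 + x * y) <= ln (1 + x) * ln (1 + y).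
Proof.
move=> xJ yJ; case: (itvJ_case x y xJ yJ) => -[].
  move=> /andP[x0 x1] /andP[y0 y1].
  have := @ln1p_ratio_nondecreasing R y x 1 y0 y1 x0 x1.
  by rewrite mul1r [X in X <= _]mulrC.
move=> x1 y1; have y0 : 0 < y by lra.
have yi1 : y^-1 <= 1 by rewrite invf_le1.
have yxy : y <= x * y by rewrite ler_pMl.
have yi0 : 0 < y^-1 by rewrite invr_gt0.
(* The parameter 1/y is what makes ln (1 + x) and ln 2 appear as numerators. *)
have := @ln1p_ratio_nondecreasing R y^-1 y (x * y) yi0 yi1 y0 yxy.
by rewrite mulfV ?gt_eqF// mulfK ?gt_eqF// [X in _ <= X]mulrC.
Qed.

Lemma itvJ_log2_submultiplicative x y : J x -> J y ->
  log2 (1 + x * y) <= log2 (1 + x) * log2 (1 + y).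
Proof.
move=> xJ yJ; have l2 : 0 < ln (2 : R) by rewrite ln_gt0// ltr1n.
rewrite /log2 ler_pdivrMr// mulrA divfK ?gt_eqF// mulrAC ler_pdivlMr//.
by rewrite mulrC itvJ_ln1p_submultiplicative.
Qed.

Lemma itvJ_log2_positive_normalized : positive_normalized J (fun x => log2 (1 + x)).
Proof.
have l2 : 0 < ln (2 : R) by rewrite ln_gt0// ltr1n.
split; last by rewrite /log2 (_ : 1 + 1 = 2)// divff// gt_eqF.
by move=> x /itvJ_gt0 x0; rewrite divr_gt0// ln_gt0//; lra.
Qed.

End Interval.

Theorem theorem3 (R : realType) (J : set R)
    (hJ : J = `]0, 1]%classic \/ J = `[1, +oo[%classic) :
  let L := fun x : R => log2 (1 + x) in
  (l_weierstrass J L /\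
   (forall x y : R, J x -> J y -> x <> 1 -> y <> 1 ->
      L x + L y - 1 < L (x * y)) /\
   weierstrass J L) /\
  (forall (n : nat) (x : 'I_n -> R), (2 <= n)%N -> (forall i, J (x i)) ->
     \prod_(i < n) (1 + x i) <= 2 ^+ n.-1 * (1 + \prod_(i < n) x i)).
Proof.
move=> L; split; last by move=> n x _; exact: itvJ_prod1D_le.
have L_norm := itvJ_log2_positive_normalized _ _ hJ.
have L_lower := itvJ_log2_l_weierstrass _ _ hJ.
split; [|split]; first by split.
  exact: itvJ_log2_l_weierstrass_strict.
split=> // x y xJ yJ.
by rewrite L_lower//= (itvJ_log2_submultiplicative _ _ hJ).
Qed.
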